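(* Let $X$ and $Y$ be non-zero Banach spaces, and let $N$ be an absolute normalised norm on $\mathbb{R}^2$. Suppose that the absolute sum $X\oplus_N Y$ has the weak-DD2P. (a) If $N$ is not the $\ell_\infty$-norm, then both $X$ and $Y$ have the weak-DD2P. (b) If $N$ is the $\ell_\infty$-norm, then at least one of the spaces $X$ or $Y$ has the weak-DD2P.
   Context: An absolute normalised norm on $\mathbb{R}^2$ is a norm $N$ with $N(a,b)=N(|a|,|b|)$ for all $(a,b)\in\mathbb{R}^2$ and $N(1,0)=N(0,1)=1$. $X\oplus_N Y$ is the product $X\times Y$ with the norm $\|(x,y)\|_N=N(\|x\|,\|y\|)$. The $\ell_\infty$-norm is $N(a,b)=\max\{|a|,|b|\}$. A Banach space $Z$ (real or complex) with closed unit ball $B_Z$ has the weak-DD2P if for every non-empty relatively weakly open subset $W$ of $B_Z$ there exists $z\in W$ such that $\sup_{y\in V}\|z-y\|=2$ for every relatively weakly open subset $V$ of $B_Z$ with $z\in V$. *)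

(* Defs.v *)
From HB Require Import structures.
From mathcomp Require Import all_boot all_order all_algebra.
From mathcomp Require Import all_classical all_reals all_analysis.
From mathcomp Require Import complex ring lra.
Set Implicit Arguments.
Unset Strict Implicit.
Unset Printing Implicit Defensive.
Import Order.TTheory GRing.Theory Num.Theory.
Import numFieldNormedType.Exports.

Local Open Scope classical_set_scope.
Local Open Scope ring_scope.

Variant scalar_kind := RealScalars | ComplexScalars.

Definition scalars (R : realType) (s : scalar_kind) : numFieldType :=
  match s with RealScalars => R | ComplexScalars => R[i] end.

Definition scalar_of_real {R : realType} (s : scalar_kind) : R -> scalars R s :=
  match s with RealScalars => id | ComplexScalars => fun r => Complex r 0 end.

Definition scalar_re {R : realType} (s : scalar_kind) : scalars R s -> R :=
  match s with RealScalars => id | ComplexScalars => @complex.Re R end.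

(* In a normed module over [scalars R s] the norm `|x| is a nonnegative real
   element of [scalars R s]; [rnorm x] is the same number, as an element of R. *)
Definition rnorm {R : realType} {s : scalar_kind}
  {Z : normedModType (scalars R s)} (x : Z) : R := scalar_re `|x|.

Section WeakTopology.
Context {K : numFieldType} (Z : normedModType K).

Definition dual := {f : {linear Z -> K^o} | continuous f}.

Definition weak_topology : topologicalType :=
  sup_topology (fun f : dual =>
    Topological.on (initial_topology (sval f : Z -> K^o))).

Definition weakly_open (U : set Z) : Prop := @open weak_topology U.

Definition unit_ball : set Z := [set z | `|z| <= 1].

Definition rel_weakly_open (W : set Z) : Prop :=
  exists2 U : set Z, weakly_open U & W = U `&` unit_ball.

End WeakTopology.

Definition weak_DD2P {R : realType} {s : scalar_kind}
    (Z : normedModType (scalars R s)) : Prop :=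
  forall W : set Z, rel_weakly_open W -> W !=set0 ->
    exists2 z, W z &
      forall V : set Z, rel_weakly_open V -> V z ->
        sup [set rnorm (z - y) | y in V] = 2.

Record absnorm (R : realType) := AbsNorm {
  absnorm_fun :> R -> R -> R;
  absnormD : forall a b c d : R,
    absnorm_fun (a + c) (b + d) <= absnorm_fun a b + absnorm_fun c d;
  absnormZ : forall k a b : R,
    absnorm_fun (k * a) (k * b) = `|k| * absnorm_fun a b;
  absnorm_eq0 : forall a b : R, absnorm_fun a b = 0 -> a = 0 /\ b = 0;
  absnorm_absolute : forall a b : R, absnorm_fun a b = absnorm_fun `|a| `|b|;
  absnorm10 : absnorm_fun 1 0 = 1;
  absnorm01 : absnorm_fun 0 1 = 1
}.

Definition is_linfty_norm {R : realType} (N : absnorm R) : Prop :=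
  forall a b : R, N a b = Num.max `|a| `|b|.

Section AbsNormTheory.
Context {R : realType} (N : absnorm R).

Lemma absnorm_oppl (a b : R) : N (- a) b = N a b.
Proof. by rewrite absnorm_absolute normrN -absnorm_absolute. Qed.

Lemma absnorm_oppr (a b : R) : N a (- b) = N a b.
Proof. by rewrite absnorm_absolute normrN -absnorm_absolute. Qed.

Lemma convex_sign_decomposition (a c : R) : 0 <= a -> a <= c ->
  exists k l : R, [/\ 0 <= k, 0 <= l, k + l = 1 & a = k * c + l * (- c)].
Proof.
move=> a0 ac; have [c0|c0] := eqVneq c 0.
  by exists 1, 0; split=> //; lra.
have cp : 0 < c by rewrite lt_def c0 (le_trans a0).
have ac1 : a / c <= 1 by rewrite ler_pdivrMr// mul1r.
have ac0 : 0 <= a / c by rewrite divr_ge0// ltW.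
exists ((1 + a / c) / 2), ((1 - a / c) / 2); split; [lra|lra|lra|by field].
Qed.

Lemma absnorm_monol (a c b : R) : 0 <= a -> a <= c -> N a b <= N c b.
Proof.
move=> a0 ac; have [k [l [k0 l0 kl ->]]] := convex_sign_decomposition a0 ac.
have {1}-> : b = k * b + l * b by rewrite -mulrDl kl mul1r.
apply: le_trans (absnormD _ _ _ _ _) _.
by rewrite !absnormZ absnorm_oppl !ger0_norm// -mulrDl kl mul1r.
Qed.

Lemma absnorm_monor (a b d : R) : 0 <= b -> b <= d -> N a b <= N a d.
Proof.
move=> b0 bd; have [k [l [k0 l0 kl ->]]] := convex_sign_decomposition b0 bd.
have {1}-> : a = k * a + l * a by rewrite -mulrDl kl mul1r.
apply: le_trans (absnormD _ _ _ _ _) _.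
by rewrite !absnormZ absnorm_oppr !ger0_norm// -mulrDl kl mul1r.
Qed.

Lemma absnorm_mono (a b c d : R) : 0 <= a -> a <= c -> 0 <= b -> b <= d ->
  N a b <= N c d.
Proof.
move=> a0 ac b0 bd.
exact: le_trans (absnorm_monol _ a0 ac) (absnorm_monor _ b0 bd).
Qed.

End AbsNormTheory.

Section ScalarTheory.
Context {R : realType} {s : scalar_kind}.

Lemma scalar_of_realD (a b : R) :
  scalar_of_real s (a + b) = scalar_of_real s a + scalar_of_real s b.
Proof. by case: s => //=; rewrite /GRing.add /= addr0. Qed.

Lemma scalar_of_real_le (a b : R) :
  (scalar_of_real s a <= scalar_of_real s b) = (a <= b).
Proof. by case: s => //=; rewrite lecE /= eqxx. Qed.

Lemma scalar_of_real0 : scalar_of_real s (0 : R) = 0.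
Proof. by case: s. Qed.

Lemma scalar_of_real_eq0 (a : R) : scalar_of_real s a = 0 -> a = 0.
Proof. by case: s => //= -[]. Qed.

Lemma scalar_of_real_norm (a : R) :
  `|scalar_of_real s a| = scalar_of_real s `|a|.
Proof.
case: s => //=; rewrite normc_def /= expr0n /= addr0.
by rewrite sqrtr_sqr.
Qed.

Lemma scalar_of_realM (a b : R) :
  scalar_of_real s (a * b) = scalar_of_real s a * scalar_of_real s b.
Proof. by case: s => //=; rewrite -!/(real_complex _ _) rmorphM. Qed.

Lemma scalar_reK (x : scalars R s) :
  0 <= x -> scalar_of_real s (scalar_re x) = x.
Proof.
case: s x => //= x; rewrite lecE /= => /andP[/eqP h _].
by case: x h => a b /= ->.
Qed.

Lemma rnormE {Z : normedModType (scalars R s)} (x : Z) :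
  scalar_of_real s (rnorm x) = `|x|.
Proof. exact: scalar_reK. Qed.

Lemma rnorm_ge0 {Z : normedModType (scalars R s)} (x : Z) : 0 <= rnorm x.
Proof. by rewrite -scalar_of_real_le rnormE scalar_of_real0. Qed.

Lemma ler_rnormD {Z : normedModType (scalars R s)} (x y : Z) :
  rnorm (x + y) <= rnorm x + rnorm y.
Proof. by rewrite -scalar_of_real_le scalar_of_realD !rnormE ler_normD. Qed.

Lemma rnorm0_eq0 {Z : normedModType (scalars R s)} (x : Z) :
  rnorm x = 0 -> x = 0.
Proof.
by move=> h; apply: normr0_eq0; rewrite -rnormE h scalar_of_real0.
Qed.

Lemma rnormZ {Z : normedModType (scalars R s)} (k : scalars R s) (x : Z) :
  rnorm (k *: x) = scalar_re `|k| * rnorm x.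
Proof.
have h a b : scalar_of_real s a = scalar_of_real s b -> a = b :> R.
  by case: (s) => //= -[].
by apply: h; rewrite scalar_of_realM (rnormE (k *: x)) (rnormE x) scalar_reK// normrZ.
Qed.

Lemma scalar_re_ge0 (x : scalars R s) : 0 <= x -> 0 <= scalar_re x.
Proof.
by move=> x0; rewrite -scalar_of_real_le scalar_of_real0 scalar_reK.
Qed.

End ScalarTheory.

Definition abs_sum {R : realType} {s : scalar_kind} (N : absnorm R)
  (X Y : normedModType (scalars R s)) : Type := (X * Y)%type.

Section AbsSum.
Context {R : realType} {s : scalar_kind} (N : absnorm R)
  (X Y : normedModType (scalars R s)).

HB.instance Definition _ := Choice.copy (abs_sum N X Y) (X * Y)%type.
HB.instance Definition _ :=
  GRing.Lmodule.copy (abs_sum N X Y) (X * Y)%type.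

Definition abs_sum_norm (z : abs_sum N X Y) : scalars R s :=
  scalar_of_real s (N (rnorm z.1) (rnorm z.2)).

Lemma ler_abs_sum_normD (z w : abs_sum N X Y) :
  abs_sum_norm (z + w) <= abs_sum_norm z + abs_sum_norm w.
Proof.
rewrite -scalar_of_realD scalar_of_real_le.
apply: le_trans (absnormD _ _ _ _ _).
by apply: absnorm_mono; rewrite ?rnorm_ge0 ?ler_rnormD.
Qed.

Lemma abs_sum_normZ (k : scalars R s) (z : abs_sum N X Y) :
  abs_sum_norm (k *: z) = `|k| * abs_sum_norm z.
Proof.
rewrite /abs_sum_norm /= !rnormZ absnormZ scalar_of_realM.
by rewrite ger0_norm ?scalar_re_ge0// scalar_reK.
Qed.

Lemma abs_sum_norm0_eq0 (z : abs_sum N X Y) : abs_sum_norm z = 0 -> z = 0.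
Proof.
move=> /scalar_of_real_eq0 /absnorm_eq0 [/rnorm0_eq0 h1 /rnorm0_eq0 h2].
by case: z h1 h2 => x y /= -> ->.
Qed.

HB.instance Definition _ := Lmodule_isNormed.Build (scalars R s)
  (abs_sum N X Y) ler_abs_sum_normD abs_sum_normZ abs_sum_norm0_eq0.

Lemma rnorm_abs_sum (z : abs_sum N X Y) : rnorm z = N (rnorm z.1) (rnorm z.2).
Proof.
rewrite /rnorm [in LHS]/Num.norm /= /abs_sum_norm.
by case: (s) X Y z.
Qed.

End AbsSum.

(* Main.v *)
Require Import Defs.
From mathcomp Require Import all_boot all_order all_algebra.
From mathcomp Require Import all_classical all_reals all_analysis.
Import numFieldNormedType.Exports.
Local Open Scope ring_scope.

From HB Require Import structures.
From mathcomp Require Import complex ring lra.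
Import Order.TTheory GRing.Theory Num.Theory.
Set Implicit Arguments.
Unset Strict Implicit.
Unset Printing Implicit Defensive.
Local Open Scope classical_set_scope.
Local Open Scope ring_scope.

(** Call z in the unit ball a super Delta-point when every relatively weakly
open V containing z satisfies sup_(y in V) |z - y| = 2; the weak-DD2P says that
these points are weakly dense in the unit ball. This property of z amounts to the
existence of an ultrafilter on the ball that converges weakly to z and along
which |z - .| tends to 2 ([super_Delta_ultra], [filter_super_Delta]).

Let z = (x, y) be a super Delta-point of the absolute sum, and pass to the
limit along such an ultrafilter: |x|, |y| are at most the limits a', b' of the
norms of the coordinates (the norm is weakly lower semicontinuous), and the
limits c, d of the distances in each coordinate satisfy c <= |x| + a',
d <= |y| + b' and N(c, d) = 2.

For the l_infty-norm, c or d is 2, so x or y is a super Delta-point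
([super_Delta_max]). If both X and Y failed the weak-DD2P, two weakly open sets
without super Delta-points would give a product without any, which is (b).

Whatever N is, the part of its unit sphere in the first quadrant contains no
horizontal segment below height 1 ([absnorm_flat]). Hence |y| < 1 forces
a' = |x| and c = 2|x|, from which x / |x| is a super Delta-point of X
([super_Delta_coord]). If N is not the l_infty-norm, then N(1, 1) > 1, and
|y| < 1 is automatic as soon as |x| is close to 1; this can be imposed by a
weakly open condition Re f(x) > 1 - eta, where f is a functional norming a given
unit vector. So every relatively weakly open subset of the ball of X that meets
the unit sphere contains a super Delta-point ([super_Delta_near_sphere]). In
particular X has one, hence is infinite-dimensional
([super_Delta_common_kernel]), and then every non-empty relatively weakly open
subset of its ball meets the sphere ([weakly_open_meets_sphere]): this is (a).

Norming functionals, over both scalar fields, come from the Hahn-Banach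
theorem, obtained below by showing that minimal sublinear functionals are
linear. *)

(** * The real-valued norm *)

Section RealNorm.
Context {R : realType} {s : scalar_kind}.
Local Notation K := (scalars R s).
Local Notation iota := (scalar_of_real s).

Lemma scalar_of_real1 : iota (1 : R) = 1.
Proof. by case: s. Qed.

Lemma scalar_of_real_lt (a b : R) : (iota a < iota b) = (a < b).
Proof.
rewrite !lt_def scalar_of_real_le; congr (~~ _ && _).
apply/eqP/eqP => [|->//].
by case: s => //= -[].
Qed.

Context {Z : normedModType K}.
Implicit Types x y z : Z.

Lemma rnorm_le_real x (a : R) : (rnorm x <= a) = (`|x| <= iota a).
Proof. by rewrite -rnormE scalar_of_real_le. Qed.

Lemma rnorm0 : rnorm (0 : Z) = 0.
Proof. by rewrite /rnorm normr0; case: s. Qed.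

Lemma rnormN x : rnorm (- x) = rnorm x.
Proof. by rewrite /rnorm normrN. Qed.

Lemma rnorm_distC x y : rnorm (x - y) = rnorm (y - x).
Proof. by rewrite -rnormN opprB. Qed.

Lemma rnormZr (t : R) x : rnorm (iota t *: x) = `|t| * rnorm x.
Proof. by rewrite rnormZ scalar_of_real_norm; congr (_ * _); case: s. Qed.

Lemma ler_rnormB x y : rnorm (x - y) <= rnorm x + rnorm y.
Proof. by rewrite (le_trans (ler_rnormD _ _))// rnormN. Qed.

Lemma ler_dist_rnorm x y : `|rnorm x - rnorm y| <= rnorm (x - y).
Proof.
rewrite ler_norml; apply/andP; split.
  have := ler_rnormD (y - x) x; rewrite subrK rnorm_distC; lra.
have := ler_rnormD (x - y) y; rewrite subrK; lra.
Qed.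

Lemma nbhs_rnormP z (A : set Z) :
  nbhs z A <-> exists2 e : R, 0 < e & forall x, rnorm (z - x) < e -> A x.
Proof.
rewrite -filter_from_norm_nbhs; split => [[e /= e0 eA]|[e e0 eA]].
  exists (scalar_re e).
    by rewrite -scalar_of_real_lt scalar_reK ?ltW// scalar_of_real0.
  move=> x xe; apply: eA => /=.
  by rewrite -rnormE -(scalar_reK (ltW e0)) scalar_of_real_lt.
exists (iota e); first by rewrite /= -scalar_of_real0 scalar_of_real_lt.
by move=> x /=; rewrite -rnormE scalar_of_real_lt; exact: eA.
Qed.

Lemma cvg_rnormP T (F : set_system T) {FF : Filter F} (u : T -> Z) z :
  u @ F --> z <->
  forall e : R, 0 < e -> \forall t \near F, rnorm (z - u t) < e.
Proof.
split=> [uz e e0|uz A /nbhs_rnormP[e e0 eA]].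
  have /uz : nbhs z [set x | rnorm (z - x) < e] by apply/nbhs_rnormP; exists e.
  by [].
by have := uz _ e0; apply: filterS => t; exact: eA.
Qed.

End RealNorm.

(** * The Hahn-Banach theorem *)

Section HahnBanach.
Context {R : realType} {s : scalar_kind} {Z : normedModType (scalars R s)}.
Local Notation iota := (scalar_of_real s).
Implicit Types (p q f : Z -> R) (x y z : Z).

(** Only multiplication by real scalars is involved, so that the same argument
serves real spaces and complex spaces viewed as real ones. *)
Definition sublinear q := (forall x y, q (x + y) <= q x + q y) /\
  (forall (t : R) x, 0 < t -> q (iota t *: x) = t * q x).

(** A way of decreasing a sublinear functional: the result is again sublinear,
lies below q, and its value at - y is at most - q y. A minimal q is therefore
odd, and even additive. *)
Definition drop_along q y x :=
  inf [set q (x + iota t *: y) - t * q y | t in [set t : R | 0 <= t]].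

Lemma sublinear0 q : sublinear q -> q 0 = 0.
Proof. by case=> _ qZ; have := qZ 2 0 ltac:(by []); rewrite scaler0; lra. Qed.

Lemma sublinear_ge_opp q x : sublinear q -> - q (- x) <= q x.
Proof.
move=> qs; have := qs.1 x (- x); rewrite subrr sublinear0//; lra.
Qed.

Lemma drop_along_lbound q y x : sublinear q ->
  lbound [set q (x + iota t *: y) - t * q y | t in [set t : R | 0 <= t]]
    (- q (- x)).
Proof.
move=> qs _ [t /= t0 <-].
have := qs.1 (- x) (x + iota t *: y); rewrite addKr => h.
have <- : q (iota t *: y) = t * q y; last by lra.
have [->|tn0] := eqVneq t 0; last by rewrite qs.2 // lt_def tn0.
by rewrite scalar_of_real0 scale0r mul0r sublinear0.
Qed.

Lemma drop_along_le q y x (t : R) : sublinear q -> 0 <= t ->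
  drop_along q y x <= q (x + iota t *: y) - t * q y.
Proof.
move=> qs t0; apply: ge_inf; last by exists t.
by exists (- q (- x)); exact: drop_along_lbound.
Qed.

Lemma le_drop_along q y x (m : R) :
  (forall t : R, 0 <= t -> m <= q (x + iota t *: y) - t * q y) ->
  m <= drop_along q y x.
Proof.
move=> h; apply: lb_le_inf; first by exists (q (x + iota 0 *: y) - 0 * q y), 0 => /=.
by move=> _ [t /= t0 <-]; exact: h.
Qed.

Lemma drop_along_le_self q y x : sublinear q -> drop_along q y x <= q x.
Proof.
move=> qs; have := drop_along_le y x qs (lexx 0).
by rewrite scalar_of_real0 scale0r addr0 mul0r subr0.
Qed.

Lemma drop_along_sublinear q y : sublinear q -> sublinear (drop_along q y).
Proof.
move=> qs; split=> [x x'|].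
  rewrite -lerBlDr; apply: le_drop_along => t t0.
  rewrite lerBlDr -lerBlDl; apply: le_drop_along => t' t'0.
  have := drop_along_le y (x + x') qs (addr_ge0 t0 t'0).
  have := qs.1 (x + iota t *: y) (x' + iota t' *: y).
  rewrite addrACA -scalerDl -scalar_of_realD; lra.
suff le (t : R) x : 0 < t -> drop_along q y (iota t *: x) <= t * drop_along q y x.
  move=> t x t0; apply/eqP; rewrite eq_le le//=.
  have ti : 0 < t^-1 by rewrite invr_gt0.
  have := le _ (iota t *: x) ti.
  rewrite scalerA -scalar_of_realM mulVf ?gt_eqF// scalar_of_real1 scale1r.
  by rewrite ler_pdivlMl.
move=> t0; rewrite -ler_pdivrMl//; apply: le_drop_along => r r0.
rewrite ler_pdivrMl//.
have := drop_along_le y (iota t *: x) qs (mulr_ge0 (ltW t0) r0).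
by rewrite scalar_of_realM -scalerA -scalerDr qs.2// -mulrA -mulrBr.
Qed.

(** Zorn's lemma applies because the infimum of a chain of sublinear functionals
below p is finite, being at least - p (- x), and subadditive: of any two members
of the chain, the smaller one bounds the infimum from above at all points. *)
Lemma sublinear_minimal p : sublinear p ->
  exists q, [/\ sublinear q, forall x, q x <= p x &
    forall r, sublinear r -> (forall x, r x <= q x) -> r = q].
Proof.
move=> ps.
pose T := {q : Z -> R | sublinear q /\ forall x, q x <= p x}.
pose leT (q r : T) := `[< forall x, sval r x <= sval q x >].
have [||||[q [qs qp]] qmin] := @Zorn T leT.
- by move=> q; apply/asboolP.
- move=> q r t /asboolP qr /asboolP rt; apply/asboolP => x.
  exact: le_trans (rt x) (qr x).
- move=> [q hq] [r hr] /asboolP /= qr /asboolP /= rq; apply: eq_exist.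
  by apply/funext => x; apply/eqP; rewrite eq_le qr rq.
- move=> A Atot; have [[q0 Aq0]|A0] := pselect (A !=set0); last first.
    have pT : sublinear p /\ forall x, p x <= p x by [].
    by exists (exist _ p pT) => q Aq; case: A0; exists q.
  pose m x := inf [set sval (q : T) x | q in A].
  have m_le (q : T) x : A q -> m x <= sval q x.
    move=> Aq; apply: ge_inf; last by exists q.
    exists (- p (- x)) => _ [[r [rs rp]] _ <-] /=.
    by have := sublinear_ge_opp x rs; have := rp (- x); lra.
  have le_m (a : R) x : (forall q : T, A q -> a <= sval q x) -> a <= m x.
    move=> h; apply: lb_le_inf; first by exists (sval q0 x), q0.
    by move=> _ [r Ar <-]; exact: h.
  have mT : sublinear m /\ forall x, m x <= p x.
    split; last by move=> x; apply: le_trans (m_le _ x Aq0) _; exact: (svalP q0).2.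
    split=> [x y|t x t0].
      rewrite -lerBlDr; apply: (le_m) => q Aq.
      rewrite lerBlDr -lerBlDl; apply: (le_m) => r Ar.
      have [/asboolP h|/asboolP h] := Atot q r Aq Ar.
        have := m_le r (x + y) Ar; have := (svalP r).1.1 x y.
        by have := h x; lra.
      have := m_le q (x + y) Aq; have := (svalP q).1.1 x y.
      by have := h y; lra.
    apply/eqP; rewrite eq_le; apply/andP; split.
      rewrite -ler_pdivrMl//; apply: le_m => q Aq; rewrite ler_pdivrMl//.
      by rewrite -(svalP q).1.2//; exact: m_le.
    apply: le_m => q Aq; rewrite (svalP q).1.2// ler_pM2l//; exact: m_le.
  by exists (exist _ m mT) => q Aq; apply/asboolP => x /=; exact: m_le.
exists q; split=> // r rs rq.
have rT : sublinear r /\ forall x, r x <= p x.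
  by split=> // x; apply: le_trans (qp x).
have := qmin (exist _ r rT) ltac:(exact/asboolP).
by move=> /(congr1 sval).
Qed.

(** A minimal f equals [drop_along f y] for all y; reading this at t = 1 gives
f x <= f (x + y) - f y, which is superadditivity. *)
Lemma hahn_banach p : sublinear p -> exists f, [/\
  {morph f : x y / x + y}, forall (t : R) x, f (iota t *: x) = t * f x &
  forall x, f x <= p x].
Proof.
move=> /sublinear_minimal[f [fs fp fmin]].
have fD : {morph f : x y / x + y}.
  move=> x y; apply/eqP; rewrite eq_le fs.1 /=.
  have := fmin _ (drop_along_sublinear y fs)
    (fun z => drop_along_le_self y z fs).
  have := drop_along_le y x fs ler01.
  by rewrite scalar_of_real1 scale1r mul1r => /[swap] ->; lra.
exists f; split=> // t x.
have fN z : f (- z) = - f z.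
  by have := fD z (- z); rewrite subrr sublinear0//; lra.
have [t0|t0|->] := ltgtP t 0; last by rewrite scalar_of_real0 scale0r mul0r sublinear0.
  have := fs.2 (- t) x ltac:(by rewrite oppr_gt0).
  have -> : iota (- t) = - iota t.
    by apply/eqP; rewrite -addr_eq0 -scalar_of_realD addNr scalar_of_real0.
  by rewrite scaleNr fN mulNr => /oppr_inj.
exact: fs.2.
Qed.

(** Starting from the norm dropped along z, rather than from the norm itself,
forces f (- z) <= - |z|. *)
Lemma hahn_banach_norming z : exists f, [/\
  {morph f : x y / x + y}, forall (t : R) x, f (iota t *: x) = t * f x,
  forall x, f x <= rnorm x & f z = rnorm z].
Proof.
have ns : sublinear (fun x => rnorm x).
  split=> [x y|t x t0]; first exact: ler_rnormD.
  by rewrite rnormZr gtr0_norm.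
have [f [fD fZ fle]] := hahn_banach (drop_along_sublinear z ns).
have f_le x : f x <= rnorm x by rewrite (le_trans (fle x))// drop_along_le_self.
exists f; split=> //; apply/eqP; rewrite eq_le f_le /=.
have := le_trans (fle (- z)) (drop_along_le z (- z) ns ler01).
have := fZ (-1) z.
have -> : iota (-1 : R) = -1.
  by apply/eqP; rewrite -addr_eq0 -scalar_of_real1 -scalar_of_realD addNr scalar_of_real0.
rewrite scalar_of_real1 scaleN1r scale1r addNr rnorm0; lra.
Qed.

End HahnBanach.

(** * Continuous functionals *)

Section Functionals.
Context {R : realType} {s : scalar_kind}.
Local Notation K := (scalars R s).
Local Notation iota := (scalar_of_real s).

Lemma norm_scalar_re_le (k : K) : `|scalar_re k| <= rnorm (k : K^o).
Proof.
rewrite -(@scalar_of_real_le R s) rnormE -scalar_of_real_norm.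
case: s k => //= -[a b]; rewrite !normc_def /= lecE /= eqxx /= expr0n /= addr0.
by rewrite ler_sqrt ?addr_ge0 ?sqr_ge0// lerDl sqr_ge0.
Qed.

Lemma scalar_reB (k l : K) : scalar_re (k - l) = scalar_re k - scalar_re l.
Proof. by case: s k l => //= -[a b] [c d]. Qed.

Lemma bounded_linear_of_rnorm (Z W : normedModType K) (f : {linear Z -> W}) (C : R) :
  (forall z, rnorm (f z) <= C * rnorm z) -> continuous f.
Proof.
move=> fC z; apply/cvg_rnormP => e e0.
have C1 : 0 < `|C| + 1 by rewrite ltr_wpDl.
have : nbhs z [set x | rnorm (z - x) < e / (`|C| + 1)].
  by apply/nbhs_rnormP; exists (e / (`|C| + 1)) => //; rewrite divr_gt0.
apply: filterS => x /=; rewrite ltr_pdivlMr// => h.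
rewrite -linearB; apply: le_lt_trans (fC _) _; apply: le_lt_trans h.
by have := ler_norm C; have := rnorm_ge0 (z - x); nra.
Qed.

Lemma dualZ (Z : normedModType K) (f : dual Z) k z :
  sval f (k *: z) = k *: (sval f z : K^o).
Proof. exact: linearZ_LR. Qed.

Lemma dualB (Z : normedModType K) (f : dual Z) x z :
  sval f (x - z) = (sval f x - sval f z : K^o).
Proof. exact: linearB. Qed.

Lemma dual_bounded (Z : normedModType K) (f : dual Z) :
  exists2 C : R, 0 <= C & forall z, rnorm (sval f z : K^o) <= C * rnorm z.
Proof.
have /cvg_rnormP/(_ 1 ltr01)/nbhs_rnormP[d d0 dP] := svalP f 0.
exists (2 / d); first by rewrite divr_ge0// ltW.
move=> z; have [->|z0] := eqVneq z 0.
  by rewrite linear0 !rnorm0 mulr0.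
have nz : 0 < rnorm z.
  by rewrite lt_def rnorm_ge0 andbT; apply: contra_neq z0 => /rnorm0_eq0.
pose t := d / (2 * rnorm z).
have t0 : 0 < t by rewrite divr_gt0// mulr_gt0.
have := dP (iota t *: z).
rewrite linear0 !sub0r !rnormN dualZ !rnormZr gtr0_norm// => h.
have {}h : t * rnorm (sval f z : K^o) < 1.
  apply: h; have -> : t * rnorm z = d / 2 by rewrite /t; field; rewrite gt_eqF.
  lra.
move: h; rewrite -ltr_pdivlMl// => /ltW/le_trans; apply.
by rewrite le_eqVlt; apply/orP; left; apply/eqP; rewrite /t; field; rewrite !gt_eqF.
Qed.

(** Real parts suffice below, hence over the complex numbers no rotation by a
phase is needed: bounding the complexification by twice the norm already makes
it continuous. *)
Lemma exists_norming_dual (Z : normedModType K) (z : Z) : exists f : dual Z,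
  (forall x, scalar_re (sval f x) <= rnorm x) /\
  scalar_re (sval f z) = rnorm z.
Proof.
have [f [fD fZ fle fz]] := hahn_banach_norming z.
have fabs x : `|f x| <= rnorm x.
  rewrite ler_norml fle andbT; have := fle (- x); rewrite rnormN.
  have := fD x (- x); rewrite subrr; have := fZ 0 0.
  by rewrite scaler0 mul0r => ->; lra.
suff [g gB gE] : exists2 g : {linear Z -> K^o},
    (forall x, rnorm (g x) <= 2 * rnorm x) & (forall x, scalar_re (g x) = f x).
  exists (exist _ g (bounded_linear_of_rnorm gB)) => /=.
  by split=> [x|]; rewrite gE.
case: s Z z f fD fZ fle fz fabs => /= Z z f fD fZ fle fz fabs.
  have flin : linear (f : Z -> R^o) by move=> k x y /=; rewrite fD fZ.
  pose fl := GRing.isLinear.Build _ _ _ _ f flin.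
  pose g : {linear Z -> R^o} := HB.pack (f : Z -> R^o) fl.
  by exists g => //= x; have := normr_ge0 (f x); have := fabs x; rewrite /rnorm /=; lra.
(* Complexification: f is the real part of z |-> f z - i f (i z). *)
pose gf (x : Z) : R[i]^o := Complex (f x) (- f (Complex 0 1 *: x)).
have glin : linear gf.
  move=> [a b] x y; rewrite /gf.
  have iotaE c : Complex c 0 = scalar_of_real ComplexScalars c by [].
  have kE w : Complex a b *: w = Complex a 0 *: w + Complex b 0 *: (Complex 0 1 *: w).
    rewrite scalerA -scalerDl; congr (_ *: _).
    by apply/eqP; rewrite eq_complex /=; apply/andP; split; apply/eqP; ring.
  have iK w : Complex 0 1 *: (Complex 0 1 *: w) = - w.
    rewrite scalerA -scaleN1r; congr (_ *: _).
    by apply/eqP; rewrite eq_complex /=; apply/andP; split; apply/eqP; ring.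
  have fN w : f (- w) = - f w.
    by have := fD w (- w); have := fZ 0 0; rewrite subrr scaler0 mul0r => ->; lra.
  have ikE w : Complex 0 1 *: (Complex a b *: w) =
      Complex a 0 *: (Complex 0 1 *: w) - Complex b 0 *: w.
    rewrite scalerA mulrC -scalerA kE iK scalerN; done.
  rewrite !scalerDr ikE kE !fD fN !iotaE !fZ.
  apply/eqP; rewrite eq_complex /=; apply/andP; split; apply/eqP; rewrite -?iotaE; ring.
pose gl := GRing.isLinear.Build _ _ _ _ gf glin.
pose g : {linear Z -> R[i]^o} := HB.pack gf gl.
exists g => //= x.
have h1 := fabs x; have := fabs (Complex 0 1 *: x).
rewrite normrZ.
have -> : `|Complex 0 1 : R[i]| = 1.
  by rewrite normc_def /= expr0n expr1n /= add0r sqrtr1.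
rewrite mul1r sqrrN; move: h1; set r := complex.Re _ => h1 h2.
have r0 : 0 <= 2 * r by rewrite mulr_ge0// (le_trans _ h1).
rewrite -[leRHS](ger0_norm r0) -sqrtr_sqr ler_sqrt ?sqr_ge0//.
rewrite -(real_normK (num_real (f x))) -(real_normK (num_real (f (_ *: x)))).
have := normr_ge0 (f x); have := normr_ge0 (f (Complex 0 1 *: x)); nra.
Qed.


End Functionals.

(** * The weak topology *)

Section WeakTopology.
Context {R : realType} {s : scalar_kind}.
Local Notation K := (scalars R s).
Local Notation iota := (scalar_of_real s).
Implicit Types Z X : normedModType K.

Lemma cvg_weakP Z (F : set_system Z) {FF : Filter F} (z : Z) :
  F --> (z : weak_topology Z) <->
  forall f : dual Z, sval f x @[x --> F] --> (sval f z : K^o).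
Proof.
rewrite cvg_sup; split=> h f.
  have hf := h f.
  apply: cvg_trans (@initial_continuous _ _ (sval f : Z -> K^o) z).
  by move=> A; exact: hf.
move=> A; rewrite (@nbhsE (initial_topology (sval f : Z -> K^o))).
move=> -[_ [[B Bo <-] Bz] BA].
apply: filterS BA _; apply: h; exact: open_nbhs_nbhs.
Qed.

Lemma unit_ballE Z (x : Z) : unit_ball x = (rnorm x <= 1) :> Prop.
Proof. by rewrite /unit_ball /= rnorm_le_real scalar_of_real1. Qed.

Lemma rel_weakly_open_interior Z (z : Z) (A : set Z) :
  nbhs (z : weak_topology Z) A -> rnorm z <= 1 ->
  exists V : set Z, [/\ rel_weakly_open V, V z & forall x, V x -> A x /\ rnorm x <= 1].
Proof.
rewrite nbhsE => -[B [Bo Bz] BA] z1.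
exists (B `&` @unit_ball K Z); split; first by exists B.
  by split=> //; rewrite unit_ballE.
by move=> x [Bx]; rewrite unit_ballE; split=> //; exact: BA.
Qed.

Lemma rel_weakly_openE Z (W : set Z) (z : Z) : rel_weakly_open W -> W z ->
  rnorm z <= 1 /\ exists2 A : set Z, nbhs (z : weak_topology Z) A &
    forall x, W x <-> A x /\ rnorm x <= 1.
Proof.
move=> [U Uo ->] [Uz]; rewrite unit_ballE => z1; split=> //.
exists U; last by move=> x; rewrite -unit_ballE.
exact: open_nbhs_nbhs.
Qed.

(** The seminorms attached to finite families of functionals generate the weak
topology ([nbhs_weak_basis]); their null spaces are the intersections of the
kernels of the family. *)
Definition dual_sum Z (fs : seq (dual Z)) (z : Z) : R :=
  \sum_(f <- fs) rnorm (sval f z : K^o).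

Lemma dual_sum_ge0 Z (fs : seq (dual Z)) z : 0 <= dual_sum fs z.
Proof. by apply: sumr_ge0 => f _; exact: rnorm_ge0. Qed.

Lemma dual_sumD Z (fs : seq (dual Z)) x y :
  dual_sum fs (x + y) <= dual_sum fs x + dual_sum fs y.
Proof.
rewrite -big_split /=; apply: ler_sum => f _.
by rewrite linearD; exact: ler_rnormD.
Qed.

Lemma dual_sumZ Z (fs : seq (dual Z)) (k : K) x :
  dual_sum fs (k *: x) = rnorm (k : K^o) * dual_sum fs x.
Proof.
rewrite mulr_sumr; apply: eq_bigr => f _.
by rewrite dualZ rnormZ.
Qed.

Lemma dual_sum_cons Z f (fs : seq (dual Z)) x :
  dual_sum (f :: fs) x = rnorm (sval f x : K^o) + dual_sum fs x.
Proof. by rewrite /dual_sum big_cons. Qed.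

Lemma dual_sum_near Z (F : set_system Z) {FF : Filter F} (z : Z)
    (fs : seq (dual Z)) (d : R) :
  F --> (z : weak_topology Z) -> 0 < d ->
  \forall x \near F, dual_sum fs (z - x) < d.
Proof.
move=> /cvg_weakP Fz; elim: fs d => [|f fs IH] d d0.
  by apply: nearW => x; rewrite /dual_sum big_nil.
have d2 : 0 < d / 2 by lra.
have /cvg_rnormP/(_ _ d2) := Fz f; have := IH _ d2.
apply: filterS2 => x h1 h2.
by rewrite dual_sum_cons dualB; lra.
Qed.

Lemma nbhs_weak_basis Z (z : Z) (A : set Z) : nbhs (z : weak_topology Z) A ->
  exists fs : seq (dual Z), exists2 d : R, 0 < d &
    forall x, dual_sum fs (z - x) < d -> A x.
Proof.
pose G := filter_from [set p : seq (dual Z) * R | 0 < p.2]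
  (fun p => [set x | dual_sum p.1 (z - x) < p.2]).
have GF : Filter G.
  apply: filter_from_filter; first by exists ([::], 1) => /=.
  move=> [fs d] [gs e] /= d0 e0; exists (fs ++ gs, Num.min d e) => /=.
    by rewrite lt_min d0.
  move=> x /=; rewrite /dual_sum big_cat lt_min => /andP[] /=.
  have := dual_sum_ge0 fs (z - x); have := dual_sum_ge0 gs (z - x).
  rewrite /dual_sum; lra.
suff /[apply] : G --> (z : weak_topology Z).
  by move=> [[fs d] /= d0 h]; exists fs, d.
apply/cvg_weakP => f; apply/cvg_rnormP => e e0.
exists ([:: f], e) => // x /=.
by rewrite dual_sum_cons /dual_sum big_nil addr0 dualB.
Qed.

(** Joint weak continuity of (t, x) |-> t x at (1, z); it is used to normalize a
vector of norm close to 1 without leaving a weak neighborhood. *)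
Lemma near_weak_scale Z (z : Z) (A : set Z) :
  nbhs (z : weak_topology Z) A -> exists2 d : R, 0 < d &
  exists2 B : set Z, nbhs (z : weak_topology Z) B &
    forall (t : R) x, `|1 - t| < d -> B x -> A (iota t *: x).
Proof.
move=> /nbhs_weak_basis[fs [d d0 fsA]].
set S := dual_sum fs z; have S0 : 0 <= S := dual_sum_ge0 fs z.
have iotaE (t : R) x : dual_sum fs (iota t *: x) = `|t| * dual_sum fs x.
  rewrite dual_sumZ; congr (_ * _).
  by rewrite /rnorm scalar_of_real_norm; case: (s).
exists (Num.min 1 (d / (2 * (S + 1)))).
  by rewrite lt_min ltr01 divr_gt0// mulr_gt0// ltr_wpDl.
exists [set x | dual_sum fs (z - x) < d / 4].
  have d4 : 0 < d / 4 by rewrite divr_gt0.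
  exact: (@dual_sum_near Z (nbhs (z : weak_topology Z)) _ z fs _ cvg_id d4).
move=> t x; rewrite lt_min => /andP[t1]; rewrite ltr_pdivlMr; last first.
  by rewrite mulr_gt0// ltr_wpDl.
move=> tS /= xd; apply: fsA.
have -> : z - iota t *: x = iota (1 - t) *: z + iota t *: (z - x).
  rewrite scalerBr addrA -scalerDl -scalar_of_realD subrK.
  by rewrite scalar_of_real1 scale1r.
apply: le_lt_trans (dual_sumD _ _ _) _; rewrite !iotaE -/S.
have t2 : `|t| <= 2.
  by have := ler_normB 1 (1 - t); rewrite subKr normr1; lra.
have := ler_wpM2r (dual_sum_ge0 fs (z - x)) t2.
have := normr_ge0 (1 - t); lra.
Qed.

Lemma dual_comp (Z X : normedModType K) (p : {linear Z -> X}) (f : dual X) :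
  continuous p ->
  exists g : dual Z, sval g =1 sval f \o p.
Proof.
move=> pc; have gc : continuous (sval f \o p : {linear Z -> K^o}).
  by move=> z; apply: continuous_comp; [exact: pc|exact: svalP f _].
by exists (exist _ (sval f \o p : {linear Z -> K^o}) gc).
Qed.

Lemma cvg_weak_linear (Z X : normedModType K) (p : {linear Z -> X}) (F : set_system Z)
    {FF : Filter F} (z : Z) : continuous p ->
  F --> (z : weak_topology Z) -> p @ F --> (p z : weak_topology X).
Proof.
move=> pc /cvg_weakP Fz; apply/cvg_weakP => f.
have [g gE] := dual_comp f pc.
apply/cvg_rnormP => e e0; have /cvg_rnormP/(_ _ e0) := Fz g.
by apply: filterS => x; rewrite !gE.
Qed.

Lemma nbhs_weak_preimage (Z X : normedModType K) (p : {linear Z -> X}) (z : Z)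
    (A : set X) : continuous p ->
  nbhs (p z : weak_topology X) A -> nbhs (z : weak_topology Z) (p @^-1` A).
Proof.
move=> pc; have FF : Filter (nbhs (z : weak_topology Z)) by exact: nbhs_filter.
exact: (cvg_weak_linear pc (@cvg_id _ (nbhs (z : weak_topology Z)))).
Qed.

Lemma nbhs_weak_functional Z (z : Z) (f : dual Z) (e : R) : 0 < e ->
  nbhs (z : weak_topology Z) [set x | rnorm (sval f z - sval f x : K^o) < e].
Proof.
move=> e0; have FF : Filter (nbhs (z : weak_topology Z)) by exact: nbhs_filter.
have /cvg_weakP/(_ f)/cvg_rnormP := @cvg_id _ (nbhs (z : weak_topology Z)).
exact.
Qed.

(** The norm is weakly lower semicontinuous: test against a functional norming
the limit. *)
Lemma weak_norm_lsc Z (F : set_system Z) {FF : ProperFilter F} (z : Z) (a : R) :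
  F --> (z : weak_topology Z) -> rnorm x @[x --> F] --> a -> rnorm z <= a.
Proof.
move=> /cvg_weakP Fz Fa; have [f [fle fz]] := exists_norming_dual z.
rewrite -fz; apply: (ler_cvg_to _ Fa); last by apply: nearW => x; exact: fle.
apply/cvgrPdist_lt => e e0; have /cvg_rnormP/(_ _ e0) := Fz f.
apply: filterS => x; apply: le_lt_trans.
by rewrite -scalar_reB norm_scalar_re_le.
Qed.

(** The distance to a finite intersection of kernels is controlled by the values
of the functionals. When the intersection is zero this makes the weak topology
as fine as the norm topology, without any appeal to dimension. Induction on the
family: a functional that does not vanish on the previous intersection is
corrected along a vector v of that intersection where it takes the value 1. *)
Lemma dual_sum_control Z (fs : seq (dual Z)) : exists2 C : R, 0 <= C &
  forall x, exists2 e, dual_sum fs e = 0 & rnorm (x - e) <= C * dual_sum fs x.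
Proof.
elim: fs => [|f fs [C C0 IH]].
  exists 0 => // x; exists x; first by rewrite /dual_sum big_nil.
  by rewrite subrr rnorm0 mul0r.
have [h|/existsNP[u /not_implyP[u0 fu]]] :=
    pselect (forall e, dual_sum fs e = 0 -> sval f e = 0).
  exists C => // x; have [e e0 xe] := IH x; exists e.
    by rewrite dual_sum_cons e0 addr0 h// rnorm0.
  apply: le_trans xe _; rewrite dual_sum_cons.
  by apply: ler_wpM2l => //; rewrite lerDr rnorm_ge0.
have [M M0 fM] := dual_bounded f.
pose v := (sval f u)^-1 *: u.
have fv : sval f v = 1 by rewrite dualZ; apply: mulVf; exact/eqP.
have v0 : dual_sum fs v = 0 by rewrite dual_sumZ u0 mulr0.
exists (C + rnorm v + M * C * rnorm v).
  by rewrite !addr_ge0 ?mulr_ge0 ?rnorm_ge0.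
move=> x; have [e e0 xe] := IH x; exists (e - sval f e *: v).
  rewrite dual_sum_cons dualB dualZ fv.
  rewrite [_ *: 1]mulr1 subrr rnorm0 add0r; apply/eqP; rewrite eq_le dual_sum_ge0 andbT.
  apply: le_trans (dual_sumD _ _ _) _.
  by rewrite e0 -scaleNr dual_sumZ v0 mulr0 addr0.
rewrite opprB addrCA dual_sum_cons; apply: le_trans (ler_rnormD _ _) _.
have -> : rnorm (sval f e *: v) = rnorm (sval f e : K^o) * rnorm v by rewrite rnormZ.
have : rnorm (sval f e : K^o) <= rnorm (sval f x : K^o) + M * rnorm (x - e).
  apply: le_trans (lerD (lexx _) (fM _)); rewrite dualB.
  by have := ler_rnormB (sval f x : K^o) (sval f x - sval f e : K^o); rewrite subKr.
have := rnorm_ge0 v; have := rnorm_ge0 (sval f x : K^o).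
have := rnorm_ge0 (x - e); have := dual_sum_ge0 fs x.
move: xe.
set a := rnorm (x - e); set S := dual_sum fs x; set b := rnorm v.
set c := rnorm (sval f x : K^o); set g := rnorm _.
move=> aS S0 a0 c0 b0 gc.
have h1 : M * a <= M * (C * S) by exact: ler_wpM2l.
have h2 : g * b <= (c + M * (C * S)) * b by apply: ler_wpM2r => //; lra.
have h3 : 0 <= c * C by exact: mulr_ge0.
have h4 : 0 <= M * C * b * c by rewrite !mulr_ge0.
have h5 : 0 <= b * S by exact: mulr_ge0.
lra.
Qed.

End WeakTopology.

(** * Super Delta-points *)

Section Ultra.
Context {R : realType} {s : scalar_kind}.
Local Notation K := (scalars R s).
Local Notation iota := (scalar_of_real s).
Implicit Types Z X : normedModType K.

Definition super_Delta_point Z (z : Z) := forall V : set Z,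
  rel_weakly_open V -> V z -> sup [set rnorm (z - y) | y in V] = 2.

Lemma ultra_bounded_cvg T (U : set_system T) (u : T -> R) (a b : R) :
  UltraFilter U -> (\forall x \near U, a <= u x <= b) ->
  exists l : R, u @ U --> l.
Proof.
move=> UU uab; have := segment_compact (a := a) (b := b).
have [G [GU UG]] := @ultraFilterLemma _ (u @ U) _.
rewrite compact_ultra => /(_ G GU)[|l [_ Gl]].
  by apply: UG; apply: filterS uab => x; rewrite /= in_itv.
exists l => A /Gl GA.
have [//|UnA] := in_ultra_setVsetC (u @^-1` A) UU.
have /UG GnA : (u @ U) (~` A) by [].
by have /filter_ex[x []] : G (A `&` ~` A) by exact: filterI.
Qed.

(** An ultrafilter rather than a net: every bounded real function then has a
limit along it, so that no subnets have to be extracted. *)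
Lemma super_Delta_ultra Z (z : Z) : rnorm z <= 1 -> super_Delta_point z ->
  exists U : set_system Z, [/\ UltraFilter U, \forall x \near U, rnorm x <= 1,
    U --> (z : weak_topology Z) & rnorm (z - x) @[x --> U] --> (2 : R)].
Proof.
move=> z1 zD; pose F := filter_from
  [set p : set Z * R | nbhs (z : weak_topology Z) p.1 /\ 0 < p.2]
  (fun p => [set x | [/\ p.1 x, rnorm x <= 1 & 2 - p.2 < rnorm (z - x)]]).
have FF : ProperFilter F.
  apply: filter_from_proper; last first.
    move=> [A e] /= [nA e0]; have [V [Vo Vz VA]] := rel_weakly_open_interior nA z1.
    have hs : has_sup [set rnorm (z - y) | y in V].
      split; first by exists (rnorm (z - z)), z.
      exists 2 => _ [y Vy <-]; have := ler_rnormB z y.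
      by have [_] := VA _ Vy; lra.
    have [_ [y Vy <-]] := sup_adherent e0 hs; rewrite (zD V)// => yd.
    by exists y; have [Ay y1] := VA _ Vy; split.
  apply: filter_from_filter; first by exists (setT, 1); split => //=; exact: filterT.
  move=> [A e] [B d] /= [nA e0] [nB d0]; exists (A `&` B, Num.min e d).
    by split; [exact: filterI|rewrite lt_min e0].
  move=> x /= [[Ax Bx] x1].
  rewrite ltrBlDr => h; have := h; rewrite -ltrBlDl lt_min => /andP[h1 h2].
  by split; split=> //; lra.
have [U [UU FU]] := ultraFilterLemma FF.
exists U; split=> //.
- apply: FU; exists (setT, 1); first by split => //=; exact: filterT.
  by move=> x [].
- move=> A nA; apply: FU; exists (A, 1); first by split.
  by move=> x [].
- apply/cvgrPdist_lt => e e0.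
  apply: FU; exists (setT, e); first by split=> //=; exact: filterT.
  move=> x /= [_ x1 h]; have := ler_rnormB z x; rewrite ltr_norml; lra.
Qed.

Lemma filter_super_Delta Z (z : Z) (F : set_system Z) {FF : ProperFilter F} :
  rnorm z <= 1 -> (\forall x \near F, rnorm x <= 1) ->
  F --> (z : weak_topology Z) -> rnorm (z - x) @[x --> F] --> (2 : R) ->
  super_Delta_point z.
Proof.
move=> z1 F1 Fz F2 V Vo Vz.
have [_ [A nA VA]] := rel_weakly_openE Vo Vz.
have ub : ubound [set rnorm (z - y) | y in V] 2.
  move=> _ [y /VA[_ y1] <-]; have := ler_rnormB z y; lra.
apply/eqP; rewrite eq_le; apply/andP; split.
  by apply: ge_sup => //; exists (rnorm (z - z)), z.
apply/ler_addgt0Pr => e e0.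
move/cvgrPdist_lt : F2 => /(_ _ e0) Fe.
have [x [[Ax x1] xe]] := filter_ex (filterI (filterI (Fz _ nA) F1) Fe).
have : rnorm (z - x) <= sup [set rnorm (z - y) | y in V].
  by apply: ub_le_sup; [exists 2|exists x => //; apply/VA].
by move: xe; rewrite ltr_norml; lra.
Qed.

End Ultra.

(** * Absolute normalised norms on the plane *)

Section TwoDim.
Context {R : realType} (N : absnorm R).

Lemma absnorm_ge_l (a b : R) : 0 <= a -> 0 <= b -> a <= N a b.
Proof.
move=> a0 b0; have := absnorm_monor N a (lexx 0) b0.
have := absnormZ N a 1 0; rewrite mulr1 mulr0 absnorm10 mulr1 ger0_norm// => -> //.
Qed.

Lemma absnorm_ge_r (a b : R) : 0 <= a -> 0 <= b -> b <= N a b.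
Proof.
move=> a0 b0; have := absnorm_monol N b (lexx 0) a0.
have := absnormZ N b 0 1; rewrite mulr1 mulr0 absnorm01 mulr1 ger0_norm// => -> //.
Qed.

Lemma absnorm_le_add (a b : R) : N a b <= `|a| + `|b|.
Proof.
have := absnormD N a 0 0 b; rewrite addr0 add0r.
have := absnormZ N a 1 0; have := absnormZ N b 0 1.
by rewrite !mulr1 !mulr0 absnorm01 absnorm10 !mulr1 => -> ->.
Qed.

Lemma cvg_absnorm T (F : set_system T) {FF : Filter F} (u v : T -> R) (a b : R) :
  u @ F --> a -> v @ F --> b -> N (u x) (v x) @[x --> F] --> N a b.
Proof.
move=> /cvgrPdist_lt ua /cvgrPdist_lt vb; apply/cvgrPdist_lt => e e0.
have e2 : 0 < e / 2 by lra.
have := vb _ e2; have := ua _ e2; apply: filterS2 => x ux vx.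
have h1 := absnormD N (a - u x) (b - v x) (u x) (v x).
have h2 := absnormD N (u x - a) (v x - b) a b.
rewrite !subrK in h1 h2.
have h3 := absnorm_le_add (a - u x) (b - v x).
have h4 := absnorm_le_add (u x - a) (v x - b).
rewrite (distrC (u x)) (distrC (v x)) in h4.
rewrite ltr_norml; lra.
Qed.

(** A horizontal segment in the first quadrant of the unit sphere lies at height
1: t |-> N (t, q) is convex, so if it is 1 at p and at most 1 at p' > p, it is at
least 1 at 0, where its value is q. *)
Lemma absnorm_flat (p p' q : R) : 0 <= p -> p < p' -> 0 <= q ->
  N p q = 1 -> N p' q <= 1 -> q = 1.
Proof.
move=> p0 pp' q0 pq p'q; apply/eqP; rewrite eq_le.
rewrite -{1}pq absnorm_ge_r//=.
have p'0 : 0 < p' by lra.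
have t0 : 0 <= p / p' by rewrite divr_ge0// ltW.
have t1 : p / p' < 1 by rewrite ltr_pdivrMr// mul1r.
set t := p / p' in t0 t1.
have := absnormD N (t * p') (t * q) ((1 - t) * 0) ((1 - t) * q).
rewrite !absnormZ (ger0_norm t0) ger0_norm; last by lra.
rewrite mulr0 addr0 -mulrDl addrC subrK mul1r /t divfK ?gt_eqF// pq -/t.
have := absnormZ N q 0 1; rewrite mulr0 mulr1 absnorm01 mulr1 ger0_norm// => ->.
have := ler_wpM2l t0 p'q; nra.
Qed.

Lemma linfty_of_absnorm11 : N 1 1 <= 1 -> is_linfty_norm N.
Proof.
move=> N1 a b; rewrite absnorm_absolute; apply/eqP; rewrite eq_le.
apply/andP; split; last first.
  by rewrite ge_max absnorm_ge_l ?absnorm_ge_r ?normr_ge0.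
set m := Num.max _ _.
have m0 : 0 <= m by rewrite le_max normr_ge0.
apply: (@le_trans _ _ (N m m)).
  by apply: absnorm_mono; rewrite ?normr_ge0 // /m le_max lexx ?orbT.
have := absnormZ N m 1 1; rewrite mulr1 ger0_norm// => ->.
by rewrite ler_piMr.
Qed.

Definition absnorm_swap : absnorm R.
Proof.
apply: (@AbsNorm R (fun a b => N b a)).
- by move=> a b c d; exact: absnormD.
- by move=> k a b; exact: absnormZ.
- by move=> a b /absnorm_eq0[].
- by move=> a b; exact: absnorm_absolute.
- exact: absnorm01.
- exact: absnorm10.
Defined.

End TwoDim.

(** * Super Delta-points of an absolute sum *)

(** The sum is handled through its two coordinate maps only, so that exchanging
the roles of X and Y costs nothing. *)
Section Coordinates.
Context {R : realType} {s : scalar_kind} (N : absnorm R).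
Local Notation K := (scalars R s).
Local Notation iota := (scalar_of_real s).
Context (Z X Y : normedModType K) (p : {linear Z -> X}) (q : {linear Z -> Y}).
Hypothesis normE : forall z, rnorm z = N (rnorm (p z)) (rnorm (q z)).

Lemma coord1_le z : rnorm (p z) <= rnorm z.
Proof. by rewrite normE absnorm_ge_l ?rnorm_ge0. Qed.

Lemma coord2_le z : rnorm (q z) <= rnorm z.
Proof. by rewrite normE absnorm_ge_r ?rnorm_ge0. Qed.

Lemma coord1_continuous : continuous p.
Proof. by apply: (bounded_linear_of_rnorm (C := 1)) => z; rewrite mul1r coord1_le. Qed.

Lemma coord2_continuous : continuous q.
Proof. by apply: (bounded_linear_of_rnorm (C := 1)) => z; rewrite mul1r coord2_le. Qed.

Lemma coord_dist_limits (z : Z) : rnorm z <= 1 -> super_Delta_point z ->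
  exists U : set_system Z, exists c d : R,
  [/\ UltraFilter U, \forall x \near U, rnorm x <= 1,
    U --> (z : weak_topology Z) & [/\ rnorm (p z - p x) @[x --> U] --> c,
    rnorm (q z - q x) @[x --> U] --> d & N c d = 2]].
Proof.
move=> z1 /(super_Delta_ultra z1)[U [UU U1 Uz U2]].
have [c Uc] : exists c : R, rnorm (p z - p x) @[x --> U] --> c.
  apply: (@ultra_bounded_cvg _ _ _ _ 0 2) => //; apply: filterS U1 => x x1.
  rewrite rnorm_ge0 -linearB; apply: le_trans (coord1_le _) _.
  by have := ler_rnormB z x; lra.
have [d Ud] : exists d : R, rnorm (q z - q x) @[x --> U] --> d.
  apply: (@ultra_bounded_cvg _ _ _ _ 0 2) => //; apply: filterS U1 => x x1.
  rewrite rnorm_ge0 -linearB; apply: le_trans (coord2_le _) _.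
  by have := ler_rnormB z x; lra.
exists U, c, d; split=> //; split=> //.
have UF : ProperFilter U by exact: ultra_proper.
have FU : Filter U by exact: filter_filter.
have := @cvg_absnorm _ N _ U FU _ _ _ _ Uc Ud.
rewrite (_ : (fun x => _) = (fun x => rnorm (z - x))); last first.
  by apply/funext => x; rewrite normE !linearB.
by move=> /(@cvg_unique _ (@Rhausdorff R)); apply.
Qed.

(** With a = |p z| and b = |q z| < 1: semicontinuity and N c d = 2 give
N a b = 1 and then, since the sphere has no horizontal segment at height b, the
norms |p x| tend to a along the ultrafilter. The same argument at height
d / 2 < 1 yields c = 2 a. *)
Lemma super_Delta_coord (z : Z) : rnorm z <= 1 -> super_Delta_point z ->
  rnorm (q z) < 1 ->
  0 < rnorm (p z) /\ super_Delta_point (iota (rnorm (p z))^-1 *: p z).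
Proof.
move=> z1 zD; have [U [c [d [UU U1 Uz [Uc Ud Ncd]]]]] := coord_dist_limits z1 zD.
set a := rnorm (p z); set b := rnorm (q z) => b1.
have a0 : 0 <= a by exact: rnorm_ge0.
have b0 : 0 <= b by exact: rnorm_ge0.
have [a' Ua'] : exists a' : R, rnorm (p x) @[x --> U] --> a'.
  apply: (@ultra_bounded_cvg _ _ _ _ 0 1) => //; apply: filterS U1 => x x1.
  by rewrite rnorm_ge0 (le_trans (coord1_le _)).
have [b' Ub'] : exists b' : R, rnorm (q x) @[x --> U] --> b'.
  apply: (@ultra_bounded_cvg _ _ _ _ 0 1) => //; apply: filterS U1 => x x1.
  by rewrite rnorm_ge0 (le_trans (coord2_le _)).
have aa' : a <= a'.
  exact: (@weak_norm_lsc _ _ _ (p @ U) _ _ _ (cvg_weak_linear coord1_continuous Uz)).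
have bb' : b <= b'.
  exact: (@weak_norm_lsc _ _ _ (q @ U) _ _ _ (cvg_weak_linear coord2_continuous Uz)).
have Na'b' : N a' b' <= 1.
  apply: (cvgr_to_le (cvg_absnorm (N := N) Ua' Ub')).
  by apply: filterS U1 => x; rewrite normE.
have c0 : 0 <= c by apply: (cvgr_to_ge Uc); apply: nearW => x; exact: rnorm_ge0.
have d0 : 0 <= d by apply: (cvgr_to_ge Ud); apply: nearW => x; exact: rnorm_ge0.
have caa' : c <= a + a'.
  apply: (ler_cvg_to Uc (cvgD (cvg_cst a) Ua')).
  by apply: nearW => x; exact: ler_rnormB.
have dbb' : d <= b + b'.
  apply: (ler_cvg_to Ud (cvgD (cvg_cst b) Ub')).
  by apply: nearW => x; exact: ler_rnormB.
have Nab : N a b = 1.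
  have := absnorm_mono N c0 caa' d0 dbb'; have := absnormD N a b a' b'.
  by move: z1; rewrite normE -/a -/b; lra.
have a'E : a' = a.
  apply/eqP; rewrite eq_le aa' andbT leNgt; apply/negP => lt_aa'.
  have : N a' b <= 1 by apply: le_trans Na'b'; exact: absnorm_monor.
  by move=> /(absnorm_flat a0 lt_aa' b0 Nab); lra.
rewrite {}a'E in Ua' aa' Na'b' caa' *.
have b'1 : b' <= 1 by apply: le_trans (absnorm_ge_r N a0 _) Na'b'; lra.
have half u v : N (u / 2) (v / 2) = N u v / 2.
  by rewrite mulrC (mulrC v) absnormZ ger0_norm// mulrC.
have c2a : c = 2 * a.
  apply/eqP; rewrite eq_le; apply/andP; split; first by lra.
  rewrite leNgt; apply/negP => lt_c.
  have c2 : 0 <= c / 2 by lra.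
  have d2 : 0 <= d / 2 by lra.
  have ca : c / 2 < a by lra.
  have N1 : N (c / 2) (d / 2) = 1 by rewrite half Ncd; lra.
  have N2 : N a (d / 2) <= 1.
    have := absnormD N a b a b'; have := absnorm_monor N (a + a) d0 dbb'.
    by have := half (a + a) d; rewrite (_ : (a + a) / 2 = a); [lra|field].
  by have := absnorm_flat c2 ca d2 N1 N2; lra.
have ap : 0 < a.
  rewrite lt_def a0 andbT; apply/eqP => a_eq0.
  have := Nab; rewrite a_eq0; have := absnormZ N b 0 1.
  by rewrite mulr0 mulr1 absnorm01 mulr1 ger0_norm// => ->; lra.
split=> //.
(* Vectors p x may exceed a = |p z| in norm; dividing by the maximum keeps their
   multiples in the ball and does not change the limits, as |p x| tends to a. *)
pose t x := a / Num.max a (rnorm (p x)).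
have max_gt0 x : 0 < Num.max a (rnorm (p x)) by rewrite lt_max ap.
have t_le1 x : `|1 - t x| <= `|a - rnorm (p x)| / a.
  rewrite /t; set m := Num.max _ _; have m0 : 0 < m := max_gt0 x.
  have am : a <= m by rewrite /m le_max lexx.
  have -> : 1 - a / m = (m - a) / m by field; rewrite gt_eqF.
  rewrite ger0_norm; last by rewrite divr_ge0 ?(ltW m0)// subr_ge0.
  apply: ler_pM; rewrite ?invr_ge0 ?(ltW m0)//; first by rewrite subr_ge0.
    rewrite /m; case: (leP a (rnorm (p x))) => [_|h].
      by rewrite distrC ler_norm.
    by rewrite subrr.
  by rewrite lef_pV2 ?posrE.
have [pa paE] : exists pa : {linear Z -> X}, forall x, pa x = iota a^-1 *: p x.
  by exists (iota a^-1 \*: p : {linear Z -> X}).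
have pa_cont : continuous pa.
  apply: (bounded_linear_of_rnorm (C := a^-1)) => x.
  rewrite paE rnormZr gtr0_norm ?invr_gt0// ler_wpM2l ?invr_ge0//; exact: coord1_le.
have t_cvg (e : R) : 0 < e -> \forall x \near U, `|1 - t x| < e.
  move=> e0; have ea : 0 < e * a by rewrite mulr_gt0.
  have /cvgrPdist_lt/(_ _ ea) := Ua'; apply: filterS => x.
  by rewrite -ltr_pdivrMr//; exact: le_lt_trans.
have UF : ProperFilter U by exact: ultra_proper.
pose u x := iota (t x) *: pa x.
rewrite -paE.
have FF : ProperFilter (u @ U) by exact: fmap_proper_filter.
apply: (@filter_super_Delta _ _ _ _ (u @ U)).
- by rewrite paE rnormZr gtr0_norm ?invr_gt0// mulVf ?gt_eqF.
- suff : \forall x \near U, rnorm (u x) <= 1 by [].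
  apply: nearW => x; rewrite /u paE !rnormZr.
  rewrite !gtr0_norm ?invr_gt0// /t ?divr_gt0// mulrA.
  rewrite (mulrAC a) divff ?gt_eqF// mul1r mulrC ler_pdivrMr// mul1r.
  by rewrite le_max lexx orbT.
- move=> A nA; have [e e0 [B nB BA]] := near_weak_scale nA.
  have FU : Filter U by exact: filter_filter.
  have /(_ _ nB) := @cvg_weak_linear _ _ _ _ pa U FU z pa_cont Uz.
  have := t_cvg _ e0; rewrite /= ; apply: filterS2 => x; exact: BA.
- apply/cvgrPdist_lt => e e0.
  have ea : 0 < e * a / 2 by rewrite divr_gt0// mulr_gt0.
  have /cvgrPdist_lt/(_ _ ea) Uce := Uc.
  have Ut := t_cvg _ ea.
  suff : \forall x \near U, `|2 - rnorm (pa z - u x)| < e by [].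
  apply: filterS3 U1 Uce Ut => x x1 xc xt.
  have px1 : rnorm (p x) <= 1 by rewrite (le_trans (coord1_le _)).
  have h1 : rnorm (pa z - pa x) = a^-1 * rnorm (p z - p x).
    by rewrite !paE -scalerBr rnormZr gtr0_norm ?invr_gt0.
  have h2 : rnorm (pa x - u x) <= a^-1 * `|1 - t x|.
    have -> : pa x - u x = iota (1 - t x) *: pa x.
      rewrite /u -{1}(scale1r (pa x)) -scalerBl; congr (_ *: _).
      apply/eqP; rewrite subr_eq -scalar_of_realD subrK scalar_of_real1 //.
    rewrite rnormZr paE rnormZr (gtr0_norm (x := a^-1)) ?invr_gt0// mulrCA.
    rewrite ler_wpM2l ?invr_ge0// mulrC ler_piMl//.
  have h3 := ler_dist_rnorm (pa z - u x) (pa z - pa x).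
  have E : pa z - u x - (pa z - pa x) = pa x - u x by rewrite opprB addrC addrA subrK.
  rewrite {}E in h3.
  have h4 : `|2 - rnorm (pa z - pa x)| < e / 2.
    have c2 : a^-1 * c = 2 by rewrite c2a; field; rewrite gt_eqF.
    rewrite h1 -{1}c2 -mulrBr normrM gtr0_norm ?invr_gt0// mulrC ltr_pdivrMr//; lra.
  have h5 : a^-1 * `|1 - t x| < e / 2 by rewrite mulrC ltr_pdivrMr//; lra.
  move: h3 h4; rewrite !ltr_norml ler_norml; lra.
Qed.

Lemma super_Delta_max (z : Z) : is_linfty_norm N ->
  rnorm z <= 1 -> super_Delta_point z ->
  super_Delta_point (p z) \/ super_Delta_point (q z).
Proof.
move=> Nmax z1 zD; have [U [c [d [UU U1 Uz [Uc Ud Ncd]]]]] := coord_dist_limits z1 zD.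
have UF : ProperFilter U by exact: ultra_proper.
have c0 : 0 <= c by apply: (cvgr_to_ge Uc); apply: nearW => x; exact: rnorm_ge0.
have d0 : 0 <= d by apply: (cvgr_to_ge Ud); apply: nearW => x; exact: rnorm_ge0.
move: Ncd; rewrite Nmax !ger0_norm//; case: leP => _ E; rewrite {}E in Uc Ud.
  right; have FF : ProperFilter (q @ U) by exact: fmap_proper_filter.
  apply: (@filter_super_Delta _ _ _ _ (q @ U)) => //.
  - by rewrite (le_trans (coord2_le _)).
  - by apply: filterS U1 => x; apply: le_trans; exact: coord2_le.
  - exact: cvg_weak_linear coord2_continuous Uz.
left; have FF : ProperFilter (p @ U) by exact: fmap_proper_filter.
apply: (@filter_super_Delta _ _ _ _ (p @ U)) => //.
- by rewrite (le_trans (coord1_le _)).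
- by apply: filterS U1 => x; apply: le_trans; exact: coord1_le.
- exact: cvg_weak_linear coord1_continuous Uz.
Qed.

End Coordinates.

(** * Weakly open sets meet the unit sphere *)

Section InfiniteDim.
Context {R : realType} {s : scalar_kind} (X : normedModType (scalars R s)).
Local Notation iota := (scalar_of_real s).

(** This is infinite dimensionality: otherwise weak convergence of the
ultrafilter to u would be norm convergence, against |u - .| tending to 2. *)
Lemma super_Delta_common_kernel (u : X) (fs : seq (dual X)) : rnorm u <= 1 ->
  super_Delta_point u -> exists2 e, e <> 0 & dual_sum fs e = 0.
Proof.
move=> u1 uD; apply: contrapT => /forall2NP ker0.
have [C C0 ctrl] := dual_sum_control fs.
have bound x : rnorm x <= C * dual_sum fs x.
  have [e e0] := ctrl x.
  have [/contrapT ->|//] := ker0 e; by rewrite subr0.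
have [U [UU _ Uu U2]] := super_Delta_ultra u1 uD.
have UF : ProperFilter U by exact: ultra_proper.
have C1 : 0 < (C + 1)^-1 by rewrite invr_gt0; lra.
have FU : Filter U by exact: filter_filter.
have Un := @dual_sum_near _ _ _ U FU u fs _ Uu C1.
have /cvgrPdist_lt/(_ _ ltr01) Uf := U2.
have [x [xn xf]] := @filter_ex _ U UF _ (filterI Un Uf).
have := bound (u - x); have := dual_sum_ge0 fs (u - x).
move: xn xf; rewrite -div1r /= ltr_pdivlMr; last by lra.
by rewrite ltr_norml; lra.
Qed.

(** Finitely many functionals define a weak neighborhood of x; moving from x
along a vector that they all kill stays inside, and reaches norm 1 by the
intermediate value theorem. *)
Lemma weakly_open_meets_sphere (W : set X) (x : X) :
  (forall fs : seq (dual X), exists2 e, e <> 0 & dual_sum fs e = 0) ->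
  rel_weakly_open W -> W x -> exists2 y, W y & rnorm y = 1.
Proof.
move=> inf Wo Wx; have [x1 [A nA WA]] := rel_weakly_openE Wo Wx.
have [fs [d d0 fsA]] := nbhs_weak_basis nA.
have [e e0 fse] := inf fs.
have en : 0 < rnorm e.
  by rewrite lt_def rnorm_ge0 andbT; apply/eqP => /rnorm0_eq0.
pose g (t : R) := rnorm (x + iota t *: e).
have gc : continuous g.
  move=> t; apply/cvgrPdist_lt => eps eps0.
  have : nbhs t [set r | `|t - r| < eps / rnorm e].
    by apply: nbhsx_ballx; rewrite divr_gt0.
  apply: filterS => r /=; rewrite ltr_pdivlMr//; apply: le_lt_trans.
  apply: le_trans (ler_dist_rnorm _ _) _.
  rewrite opprD addrACA subrr add0r -scaleNr -scalerDl.
  have -> : iota t - iota r = iota (t - r).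
    by apply/eqP; rewrite subr_eq -scalar_of_realD subrK.
  by rewrite rnormZr.
have T0 : 0 <= 2 / rnorm e by rewrite divr_ge0// ltW.
have [|t _ gt1] := @IVT R g 0 (2 / rnorm e) 1 T0 (continuous_subspaceT gc).
  have g0 : g 0 <= 1 by rewrite /g scalar_of_real0 scale0r addr0.
  have gT : 1 <= g (2 / rnorm e).
    have := ler_rnormB (x + iota (2 / rnorm e) *: e) x.
    rewrite [x + _]addrC addrK rnormZr ger0_norm// divfK ?gt_eqF//.
    by rewrite /g (addrC x); lra.
  by rewrite ge_min g0 le_max gT orbT.
exists (x + iota t *: e) => //; apply/WA; split; last by rewrite -/(g t) gt1.
apply: fsA; rewrite opprD addrA subrr add0r -scaleNr dual_sumZ fse mulr0//.
Qed.

End InfiniteDim.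

(** * Inheritance by the summands *)

Section Inherit.
Context {R : realType} {s : scalar_kind} (N : absnorm R).
Local Notation K := (scalars R s).
Local Notation iota := (scalar_of_real s).
Context (Z X Y : normedModType K) (p : {linear Z -> X}) (q : {linear Z -> Y}).
Hypothesis normE : forall z, rnorm z = N (rnorm (p z)) (rnorm (q z)).
Hypothesis pq_surj : forall x y, exists2 z, p z = x & q z = y.
Hypothesis ZD : weak_DD2P Z.

Lemma weak_DD2P_either_coord : is_linfty_norm N -> weak_DD2P X \/ weak_DD2P Y.
Proof.
move=> Nmax; apply: contrapT => /not_orP[].
move=> /existsNP[W1 /not_implyP[W1o /not_implyP[[x W1x] noX]]].
move=> /existsNP[W2 /not_implyP[W2o /not_implyP[[y W2y] noY]]].
have [x1 [A nA W1A]] := rel_weakly_openE W1o W1x.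
have [y1 [B nB W2B]] := rel_weakly_openE W2o W2y.
have [z0 pz0 qz0] := pq_surj x y.
have z01 : rnorm z0 <= 1.
  by rewrite normE Nmax !ger0_norm ?rnorm_ge0// pz0 qz0 ge_max x1.
rewrite -pz0 in nA; rewrite -qz0 in nB.
have nAB : nbhs (z0 : weak_topology Z) (p @^-1` A `&` q @^-1` B).
  exact: filterI (nbhs_weak_preimage (coord1_continuous normE) nA)
    (nbhs_weak_preimage (coord2_continuous normE) nB).
have [V [Vo Vz0 VAB]] := rel_weakly_open_interior nAB z01.
have [z Vz zD] := ZD Vo ltac:(by exists z0).
have [[Az Bz] z1] := VAB _ Vz.
have [pD|qD] := super_Delta_max normE Nmax z1 zD.
  apply: noX; exists (p z) => //; apply/W1A; split=> //.
  exact: le_trans (coord1_le normE z) z1.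
apply: noY; exists (q z) => //; apply/W2B; split=> //.
exact: le_trans (coord2_le normE z) z1.
Qed.

Hypothesis N11 : 1 < N 1 1.

(** The super Delta-point z is taken in the weakly open set of all z with p z
close to x and Re f (p z) > 1 - eta, where f norms x. Then |p z| > 1 - eta, and
|q z| >= 1 would give N (1 - eta, 1) <= 1, which the third bound on eta excludes.
The first two bounds on eta keep p z / |p z| within the scaling tolerance d. *)
Lemma super_Delta_near_sphere (W : set X) (x : X) : rel_weakly_open W -> W x ->
  rnorm x = 1 -> exists2 u, W u & super_Delta_point u.
Proof.
move=> Wo Wx x1; have [_ [A nA WA]] := rel_weakly_openE Wo Wx.
have [d d0 [B nB BA]] := near_weak_scale nA.
have [f [fle fx]] := exists_norming_dual x.
have [z0 pz0 qz0] := pq_surj x 0.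
have z01 : rnorm z0 <= 1.
  by rewrite normE pz0 qz0 rnorm0 x1 absnorm10.
pose eta := Num.min (1 / 2) (Num.min (d / 2) ((N 1 1 - 1) / 2)).
have eta0 : 0 < eta by rewrite !lt_min !divr_gt0// subr_gt0.
have [eta2 etad etaN] : [/\ eta <= 1/2, eta <= d / 2 & eta <= (N 1 1 - 1) / 2].
  by split; rewrite /eta !ge_min lexx ?orbT.
pose C := [set z | B (p z) /\ 1 - eta < scalar_re (sval f (p z))].
have nC : nbhs (z0 : weak_topology Z) C.
  apply: (nbhs_weak_preimage (A := [set y | B y /\ 1 - eta < scalar_re (sval f y)])
    (coord1_continuous normE)).
  rewrite pz0; apply: filterI nB _.
  apply: filterS (nbhs_weak_functional x f eta0) => y /=.
  have := norm_scalar_re_le (sval f x - sval f y).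
  rewrite scalar_reB fx x1 => /le_lt_trans /[apply].
  by rewrite ltr_norml; lra.
have [V [Vo Vz0 VC]] := rel_weakly_open_interior nC z01.
have [z Vz zD] := ZD Vo ltac:(by exists z0).
have [[Bz fz] z1] := VC _ Vz.
have pz : 1 - eta < rnorm (p z) by apply: lt_le_trans fz (fle _).
have qz : rnorm (q z) < 1.
  rewrite ltNge; apply/negP => qz.
  have e1 : 0 <= 1 - eta by lra.
  have := absnorm_mono N e1 (ltW pz) ler01 qz; rewrite -normE.
  have := absnormD N (1 - eta) 1 eta 0; have := absnorm_le_add N eta 0.
  rewrite subrK addr0 normr0 addr0 (ger0_norm (ltW eta0)); lra.
have [pz0' pzD] := super_Delta_coord normE z1 zD qz.
have pz1 : rnorm (p z) <= 1 by rewrite (le_trans (coord1_le normE z)).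
exists (iota (rnorm (p z))^-1 *: p z) => //; apply/WA; split; last first.
  by rewrite rnormZr gtr0_norm ?invr_gt0// mulVf ?gt_eqF.
apply: BA => //; set r := rnorm (p z) in pz pz0' pz1 *.
have -> : 1 - r^-1 = - ((1 - r) / r) by field; rewrite gt_eqF.
rewrite normrN ger0_norm; last by rewrite divr_ge0 ?(ltW pz0')// subr_ge0.
by rewrite ltr_pdivrMr//; nra.
Qed.

Lemma weak_DD2P_coord : (exists x : X, x <> 0) -> weak_DD2P X.
Proof.
move=> [x x0].
have xn : 0 < rnorm x.
  by rewrite lt_def rnorm_ge0 andbT; apply/eqP => /rnorm0_eq0.
pose v := iota (rnorm x)^-1 *: x.
have v1 : rnorm v = 1 by rewrite rnormZr gtr0_norm ?invr_gt0// mulVf ?gt_eqF.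
have v1' : rnorm v <= 1 by rewrite v1.
have [V [Vo Vv VA]] := rel_weakly_open_interior
  (filterT : nbhs (v : weak_topology X) setT) v1'.
have [u Vu uD] := super_Delta_near_sphere Vo Vv v1.
have [_ u1] := VA _ Vu.
move=> W Wo [y Wy].
have [w Ww w1] := weakly_open_meets_sphere
  (fun fs => super_Delta_common_kernel fs u1 uD) Wo Wy.
by have [a Wa aD] := super_Delta_near_sphere Wo Ww w1; exists a.
Qed.

End Inherit.

Theorem proposition3p4 (R : realType) (s : scalar_kind)
  (X Y : completeNormedModType (scalars R s)) (N : absnorm R)
  (hX : exists x : X, x <> 0) (hY : exists y : Y, y <> 0)
  (hXY : weak_DD2P (abs_sum N X Y)) :
  (~ is_linfty_norm N -> weak_DD2P X /\ weak_DD2P Y) /\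
  (is_linfty_norm N -> weak_DD2P X \/ weak_DD2P Y).
Proof.
pose Z : normedModType (scalars R s) := abs_sum N X Y.
pose p : {linear Z -> X} := (fst : {linear (X * Y)%type -> X}).
pose q : {linear Z -> Y} := (snd : {linear (X * Y)%type -> Y}).
have normE (z : Z) : rnorm z = N (rnorm (p z)) (rnorm (q z)) by exact: rnorm_abs_sum.
split=> [notinf|inf].
  have N11 : 1 < N 1 1.
    by rewrite ltNge; apply/negP => /linfty_of_absnorm11.
  split.
    apply: (weak_DD2P_coord normE _ hXY N11 hX).
    by move=> x y; exists (x, y).
  have normE' (z : Z) : rnorm z = absnorm_swap N (rnorm (q z)) (rnorm (p z)).
    exact: normE.
  apply: (weak_DD2P_coord normE' _ hXY N11 hY).
  by move=> x y; exists (y, x).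
apply: (weak_DD2P_either_coord normE _ hXY inf).
by move=> x y; exists (x, y).
Qed.
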